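(* Let $k$ be an $F$-finite field of characteristic $p>0$, and let $R$ be a strongly $F$-regular $k$-algebra, essentially of finite type over $k$, such that the second diagonal Cartier algebra $\mathscr D^{(2)}(R/k)$ is $F$-split. Let $\mathfrak a\subseteq R$ be an ideal not contained in any minimal prime of $R$, and let $s,t>0$ be real numbers with $s+t\in\mathbb Z$. Then $$\mathfrak a^{s+t}\subseteq \tau(\mathfrak a^{s-\epsilon})\,\tau(\mathfrak a^{t-\epsilon})$$ for all real $\epsilon\in(0,\min\{s,t\}]$.
   Context: All rings are commutative. For a ring $R$ of prime characteristic $p$ and $e\ge 0$, $F^e_*$ denotes restriction of scalars along the $e$-th iterate of Frobenius $F^e\colon R\to R$, $x\mapsto x^{p^e}$: for an $R$-module $M$, $F^e_*M=\{F^e_*m : m\in M\}$ with $F^e_*m+F^e_*n=F^e_*(m+n)$ and $rF^e_*m=F^e_*(r^{p^e}m)$. $R$ is $F$-finite if $F^e_*R$ is a finitely generated $R$-module for some (equivalently all) $e>0$. An $F$-splitting of $R$ is an $R$-linear map $F^e_*R\to R$ (with $e>0$) sending $F^e_*1$ to $1$. Let $R$ be $F$-finite, reduced and Noetherian of characteristic $p$, and let $R^\circ$ be the set of elements of $R$ not in any minimal prime. $R$ is strongly $F$-regular if for every $d\in R^\circ$ there exist $e>0$ and $\varphi\in\operatorname{Hom}_R(F^e_*R,R)$ with $\varphi(F^e_*d)=1$. Test ideals: let $\mathfrak a$ be an ideal of $R$ not contained in any minimal prime and $t\ge 0$ a real number. A test element of the pair $(R,\mathfrak a^t)$ is an element $c\in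 R^\circ$ such that for all $d\in R^\circ$ there exist $e>0$ and $\varphi\in \operatorname{Hom}_R(F^e_*R,R)$ with $c\in\varphi\big(F^e_*(d\,\mathfrak a^{\lceil t(p^e-1)\rceil})\big)$. Test elements exist, and $$\tau(\mathfrak a^t)=\tau(R,\mathfrak a^t)=\sum_{e>0}\ \sum_{\varphi\in\operatorname{Hom}_R(F^e_*R,R)}\varphi\big(F^e_*(c\,\mathfrak a^{\lceil t(p^e-1)\rceil})\big),$$ where $c$ is any test element of $(R,\mathfrak a^t)$ (the ideal does not depend on $c$). By convention $\mathfrak a^0=R$. Diagonal Cartier algebra: let $\mu\colon R\otimes_kR\to R$, $\mu(x\otimes y)=xy$. The degree-$e$ piece $\mathscr D^{(2)}_e(R/k)$ of $\mathscr D^{(2)}(R/k)=\bigoplus_e\mathscr D^{(2)}_e(R/k)$ is the set of all $\psi\in\operatorname{Hom}_R(F^e_*R,R)$ that have a lift to $R\otimes_kR$, i.e. for which there is an $(R\otimes_kR)$-linear map $\widehat\psi\colon F^e_*(R\otimes_kR)\to R\otimes_kR$ with $\mu\circ\widehat\psi=\psi\circ F^e_*\mu$. $\mathscr D^{(2)}(R/k)$ is $F$-split if $\mathscr D^{(2)}_e(R/k)$ contains an $F$-splitting of $R$ for some $e>0$. *)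

(* Defs.v *)
From HB Require Import structures.
From mathcomp Require Import all_boot all_order all_algebra.
From mathcomp Require Import boolp classical_sets reals.

Set Implicit Arguments.
Unset Strict Implicit.
Unset Printing Implicit Defensive.

Import Order.TTheory GRing.Theory Num.Theory.
Local Open Scope classical_set_scope.
Local Open Scope ring_scope.
Local Open Scope quotient_scope.

(** Rings are [comPzRingType]s, so the zero ring is allowed; a [k]-algebra is
    a ring [R] together with its structure morphism [k -> R]. *)

Section Ideals.
Variable R : comPzRingType.
Implicit Types (I J P : set R) (d : R).

Definition is_ideal I :=
  [/\ I 0, forall x y, I x -> I y -> I (x + y) & forall r x, I x -> I (r * x)].

Definition is_prime_ideal P :=
  [/\ is_ideal P, ~ P 1 & forall x y, P (x * y) -> P x \/ P y].

Definition is_minimal_prime P :=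
  is_prime_ideal P /\
  forall Q : set R, is_prime_ideal Q -> Q `<=` P -> Q = P.

Definition Rcirc : set R := [set d | forall P, is_minimal_prime P -> ~ P d].

(** Finite sums of elements of [X]. When [X] is a union of ideals this is the
    sum of these ideals. *)
Definition add_span (X : set R) : set R :=
  [set x | exists2 s : seq R, {in s, forall y, X y} & x = \sum_(y <- s) y].

Definition ideal_mul I J : set R :=
  add_span [set z | exists x y, [/\ I x, J y & z = x * y]].

Definition ideal_pow I n : set R := iter n (ideal_mul I) setT.

End Ideals.

Definition lin_span (R : pzRingType) (M : lmodType R) (s : seq M) : set M :=
  [set x | exists c : 'I_(size s) -> R, x = \sum_i c i *: s`_i].

Definition noetherian (R : comPzRingType) :=
  forall I : set R, is_ideal I -> exists s : seq R^o, I = lin_span s.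

Definition is_reduced (R : comPzRingType) :=
  forall (x : R) n, x ^+ n = 0 -> x = 0.

(** The only subset containing the image of [k] and the elements of [s], and
    closed under sums and products, is the whole algebra (closure under
    opposites follows, as it contains the image of [-1]). *)
Definition finite_type (k A : comPzRingType) (f : {rmorphism k -> A}) :=
  exists s : seq A, forall B : set A,
    (forall c, B (f c)) -> {in s, forall x, B x} ->
    (forall x y, B x -> B y -> B (x + y)) ->
    (forall x y, B x -> B y -> B (x * y)) -> B = setT.

Definition mult_closed (A : comPzRingType) (W : set A) :=
  W 1 /\ forall x y, W x -> W y -> W (x * y).

(** [g : A -> R] exhibits [R] as the ring of fractions of [A] with
    denominators in [W]. *)
Definition is_localization (A R : comPzRingType) (W : set A)
    (g : {rmorphism A -> R}) :=
  [/\ forall w, W w -> exists u, g w * u = 1,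
      forall r, exists x w, W w /\ r * g w = g x &
      forall x, g x = 0 -> exists2 w, W w & w * x = 0].

Definition ess_finite_type (k R : comPzRingType) (f : {rmorphism k -> R}) :=
  exists (A : comPzRingType) (h : {rmorphism k -> A}) (W : set A)
         (g : {rmorphism A -> R}),
    [/\ finite_type h, mult_closed W, is_localization W g &
        forall c, g (h c) = f c].

(** The condition defining [p \in [pchar R]], which the library only provides
    for nonzero rings. *)
Definition has_char (p : nat) (R : pzRingType) : bool :=
  prime p && (p%:R == 0 :> R).

Lemma has_char_pchar p (R : nzRingType) : p \in [pchar R] -> has_char p R.
Proof. by []. Qed.

Lemma has_char_rmorph p (R S : pzRingType) (f : {rmorphism R -> S}) :
  has_char p R -> has_char p S.
Proof.
by case/andP=> p_pr /eqP p0; rewrite /has_char p_pr -(rmorph_nat f) p0 rmorph0 eqxx.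
Qed.

Lemma frob_exprD p (R : comPzRingType) e (x y : R) : has_char p R ->
  (x + y) ^+ (p ^ e) = x ^+ (p ^ e) + y ^+ (p ^ e).
Proof.
case/andP=> p_pr /eqP p0; elim: e => [|e IHe]; first by rewrite !expn0 !expr1.
rewrite !expnSr !exprM {}IHe; move: (x ^+ _) (y ^+ _) => {}x {}y.
have defp := prednK (prime_gt0 p_pr).
rewrite exprDn -defp big_ord_recl big_ord_recr /= subnn subn0 !bin0 binn defp.
rewrite !expr0 mul1r mulr1 !mulr1n /bump /= add1n defp.
rewrite big1 ?add0r // => i _; rewrite /bump /= add1n.
have /dvdnP[m ->] : (p %| 'C(p, i.+1))%N.
  by rewrite prime_dvd_bin //= -{2}defp ltnS (valP i).
by rewrite mulrnA -[_ *+ p]mulr_natl p0 mul0r.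
Qed.

(** [F^e_* R]: the abelian group [R], on which [r] acts as multiplication by
    [r ^ (p ^ e)]. *)
Section Pushforward.
Variables (p : nat) (R : comPzRingType) (chR : has_char p R) (e : nat).

Definition Fpush of has_char p R & nat : Type := R.
Local Notation FR := (Fpush chR e).

HB.instance Definition _ := GRing.Zmodule.on FR.

Definition Fstar (x : R) : FR := x.

Definition Fpush_scale (r : R) (x : FR) : FR := Fstar (r ^+ (p ^ e) * (x : R)).

Fact Fpush_scaleA a b v : Fpush_scale a (Fpush_scale b v) = Fpush_scale (a * b) v.
Proof. by rewrite /Fpush_scale /Fstar exprMn mulrA. Qed.
Fact Fpush_scale1 : left_id 1 Fpush_scale.
Proof. by move=> v; rewrite /Fpush_scale /Fstar expr1n mul1r. Qed.
Fact Fpush_scaleDr : right_distributive Fpush_scale +%R.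
Proof. by move=> a u v; rewrite /Fpush_scale /Fstar mulrDr. Qed.
Fact Fpush_scaleDl v : {morph Fpush_scale^~ v : a b / a + b}.
Proof. by move=> a b; rewrite /Fpush_scale /Fstar (frob_exprD _ _ _ chR) mulrDl. Qed.

HB.instance Definition _ := GRing.Zmodule_isLmodule.Build R FR
  Fpush_scaleA Fpush_scale1 Fpush_scaleDr Fpush_scaleDl.

Lemma Fpush_scaleE (r x : R) : r *: Fstar x = Fstar (r ^+ (p ^ e) * x).
Proof. by []. Qed.

Lemma FstarD (x y : R) : Fstar (x + y) = Fstar x + Fstar y.
Proof. by []. Qed.

End Pushforward.

(** [A (x)_k B] is built as the commutative monoid generated by the pairs
    [(x, y)] modulo the bilinearity relations; formal sums of pairs are
    represented by lists. *)
Section Tensor.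
Variables (k A B : comPzRingType).
Variables (f : {rmorphism k -> A}) (g : {rmorphism k -> B}).

Inductive tensor_rel : seq (A * B) -> seq (A * B) -> Prop :=
| tensor_refl s : tensor_rel s s
| tensor_sym s t : tensor_rel s t -> tensor_rel t s
| tensor_trans s t u : tensor_rel s t -> tensor_rel t u -> tensor_rel s u
| tensor_cat s s' t t' :
    tensor_rel s s' -> tensor_rel t t' -> tensor_rel (s ++ t) (s' ++ t')
| tensor_catC s t : tensor_rel (s ++ t) (t ++ s)
| tensor_0l y : tensor_rel [:: (0, y)] [::]
| tensor_0r x : tensor_rel [:: (x, 0)] [::]
| tensor_Dl x x' y : tensor_rel [:: (x + x', y)] [:: (x, y); (x', y)]
| tensor_Dr x y y' : tensor_rel [:: (x, y + y')] [:: (x, y); (x, y')]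
| tensor_Z c x y : tensor_rel [:: (f c * x, y)] [:: (x, g c * y)].

Definition tensor_relb : rel (seq (A * B)) := fun s t => `[< tensor_rel s t >].

Fact tensor_relb_refl : reflexive tensor_relb.
Proof. by move=> s; apply/asboolP/tensor_refl. Qed.
Fact tensor_relb_sym : symmetric tensor_relb.
Proof. by move=> s t; apply/asboolP/asboolP => /tensor_sym. Qed.
Fact tensor_relb_trans : transitive tensor_relb.
Proof.
by move=> t s u /asboolP st /asboolP tu; apply/asboolP/(tensor_trans st tu).
Qed.

Canonical tensor_equiv :=
  EquivRel tensor_relb tensor_relb_refl tensor_relb_sym tensor_relb_trans.

Definition tensor : Type := {eq_quot tensor_equiv}.
HB.instance Definition _ := Choice.on tensor.
HB.instance Definition _ := EqQuotient.on tensor.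

Lemma tensor_eqP s t : \pi_tensor s = \pi_tensor t <-> tensor_rel s t.
Proof.
split=> [/eqquotP/asboolP // | st]; by apply/eqquotP/asboolP.
Qed.

Lemma tensor_repr s : tensor_rel (repr (\pi_tensor s)) s.
Proof. by apply/tensor_eqP; rewrite reprK. Qed.

Lemma tensor_reprK (z : tensor) : \pi_tensor (repr z) = z.
Proof. exact: reprK. Qed.

Definition tensor_add (z w : tensor) : tensor := \pi_tensor (repr z ++ repr w).
Definition tensor_opp (z : tensor) : tensor :=
  \pi_tensor [seq (- u.1, u.2) | u <- repr z].

Lemma tensor_add_pi s t :
  tensor_add (\pi_tensor s) (\pi_tensor t) = \pi_tensor (s ++ t).
Proof.
rewrite /tensor_add; apply/tensor_eqP.
by apply: tensor_cat; apply: tensor_repr.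
Qed.

Fact tensor_addA : associative tensor_add.
Proof.
move=> x y z; rewrite -[x]tensor_reprK -[y]tensor_reprK -[z]tensor_reprK.
by rewrite !tensor_add_pi catA.
Qed.
Fact tensor_addC : commutative tensor_add.
Proof.
by move=> x y; rewrite /tensor_add; apply/tensor_eqP; apply: tensor_catC.
Qed.
Fact tensor_add0 : left_id (\pi_tensor [::]) tensor_add.
Proof. by move=> x; rewrite -[x]tensor_reprK tensor_add_pi. Qed.
Fact tensor_addN : left_inverse (\pi_tensor [::]) tensor_opp tensor_add.
Proof.
move=> x; rewrite -{2}[x]tensor_reprK tensor_add_pi; apply/tensor_eqP.
elim: (repr x) => [|[u v] s IHs]; first exact: tensor_refl.
have h : tensor_rel [:: (- u, v); (u, v)] [::].
  apply: tensor_trans (tensor_0l v); apply: tensor_sym.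
  by rewrite -{1}(addNr u); apply: tensor_Dl.
apply: tensor_trans (tensor_cat h IHs) => /=.
rewrite -cat1s -[X in tensor_rel _ X]cat1s.
apply: tensor_cat; first exact: tensor_refl.
rewrite -cat1s -[X in tensor_rel _ X]cat1s !catA.
by apply: tensor_cat; [exact: tensor_catC | exact: tensor_refl].
Qed.

HB.instance Definition _ := GRing.isZmodule.Build tensor
  tensor_addA tensor_addC tensor_add0 tensor_addN.

Definition tens (x : A) (y : B) : tensor := \pi_tensor [:: (x, y)].

Lemma tensor_piE s : \pi_tensor s = \sum_(u <- s) tens u.1 u.2.
Proof.
elim: s => [|[x y] s IHs]; first by rewrite big_nil.
by rewrite big_cons -IHs [RHS]tensor_add_pi.
Qed.

Lemma tensor_ind (P : tensor -> Prop) : P 0 ->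
  (forall z w, P z -> P w -> P (z + w)) -> (forall x y, P (tens x y)) ->
  forall z, P z.
Proof. by move=> P0 PD Pt z; rewrite -[z]tensor_reprK tensor_piE; apply: big_ind. Qed.

Lemma tensDl x x' y : tens (x + x') y = tens x y + tens x' y.
Proof.
by rewrite [RHS]tensor_add_pi; apply/tensor_eqP; apply: tensor_Dl.
Qed.
Lemma tensDr x y y' : tens x (y + y') = tens x y + tens x y'.
Proof.
by rewrite [RHS]tensor_add_pi; apply/tensor_eqP; apply: tensor_Dr.
Qed.
Lemma tensZ c x y : tens (f c * x) y = tens x (g c * y).
Proof. by apply/tensor_eqP; apply: tensor_Z. Qed.

Definition balanced (V : zmodType) (h : A -> B -> V) :=
  [/\ forall x x' y, h (x + x') y = h x y + h x' y,
      forall x y y', h x (y + y') = h x y + h x y' &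
      forall c x y, h (f c * x) y = h x (g c * y)].

Definition tensor_lift (V : zmodType) (h : A -> B -> V) (z : tensor) : V :=
  \sum_(u <- repr z) h u.1 u.2.

Section Lift.
Variables (V : zmodType) (h : A -> B -> V) (hP : balanced h).

Lemma tensor_lift_pi s : tensor_lift h (\pi_tensor s) = \sum_(u <- s) h u.1 u.2.
Proof.
case: hP => hDl hDr hZ; rewrite /tensor_lift.
move: (repr _) (tensor_repr s) => s' st; elim: st => {s s'} //=.
- by move=> s t u _ -> _ ->.
- by move=> s s' t t' _ IHs _ IHt; rewrite !big_cat /= IHs IHt.
- by move=> s t; rewrite !big_cat /= addrC.
- move=> y; rewrite big_seq1 big_nil /=.
  by apply: (addrI (h 0 y)); rewrite -hDl !addr0.
- move=> x; rewrite big_seq1 big_nil /=.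
  by apply: (addrI (h x 0)); rewrite -hDr !addr0.
- by move=> x x' y; rewrite big_seq1 big_cons big_seq1 hDl.
- by move=> x y y'; rewrite big_seq1 big_cons big_seq1 hDr.
- by move=> c x y; rewrite !big_seq1 hZ.
Qed.

Lemma tensor_lift_tens x y : tensor_lift h (tens x y) = h x y.
Proof. by rewrite tensor_lift_pi big_seq1. Qed.

Lemma tensor_liftD : {morph tensor_lift h : z w / z + w}.
Proof.
move=> z w; have -> : z + w = \pi_tensor (repr z ++ repr w) by [].
by rewrite tensor_lift_pi big_cat.
Qed.

Lemma tensor_lift0 : tensor_lift h 0 = 0.
Proof.
have -> : 0 = \pi_tensor [::] :> tensor by [].
by rewrite tensor_lift_pi big_nil.
Qed.

End Lift.

Definition tensor_mull (x : A) (y : B) : tensor -> tensor :=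
  tensor_lift (fun x' y' => tens (x * x') (y * y')).

Lemma tensor_mull_bal x y : balanced (fun x' y' => tens (x * x') (y * y')).
Proof.
split=> *; rewrite ?mulrDr ?tensDl ?tensDr //.
by rewrite mulrCA tensZ mulrCA.
Qed.

Lemma tensor_mull0 x y : tensor_mull x y 0 = 0.
Proof. exact/tensor_lift0/tensor_mull_bal. Qed.
Lemma tensor_mullD x y : {morph tensor_mull x y : z w / z + w}.
Proof. exact/tensor_liftD/tensor_mull_bal. Qed.
Lemma tensor_mull_tens x y x' y' :
  tensor_mull x y (tens x' y') = tens (x * x') (y * y').
Proof. exact/tensor_lift_tens/tensor_mull_bal. Qed.

Definition tensor_mul (z w : tensor) : tensor :=
  tensor_lift (fun x y => tensor_mull x y w) z.

Lemma tensor_mul_bal w : balanced (fun x y => tensor_mull x y w).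
Proof.
split=> [x x' y | x y y' | c x y]; elim/tensor_ind: w => [|z w IHz IHw|u v];
  rewrite ?tensor_mull0 ?addr0 // ?tensor_mullD ?IHz ?IHw 1?addrACA //.
- by rewrite !tensor_mull_tens mulrDl tensDl.
- by rewrite !tensor_mull_tens mulrDl tensDr.
- by rewrite !tensor_mull_tens -!mulrA tensZ.
Qed.

Lemma tensor_mul_tens x y x' y' :
  tensor_mul (tens x y) (tens x' y') = tens (x * x') (y * y').
Proof.
rewrite /tensor_mul tensor_lift_tens; last exact: tensor_mul_bal.
exact: tensor_mull_tens.
Qed.

Fact tensor_mulDl : left_distributive tensor_mul +%R.
Proof. by move=> z w v; apply/tensor_liftD/tensor_mul_bal. Qed.

Fact tensor_mul0l z : tensor_mul 0 z = 0.
Proof. exact/tensor_lift0/tensor_mul_bal. Qed.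

Lemma tensor_mul0r z : tensor_mul z 0 = 0.
Proof.
by rewrite /tensor_mul /tensor_lift big1 // => u _; apply: tensor_mull0.
Qed.

Lemma tensor_mulDr : right_distributive tensor_mul +%R.
Proof.
move=> z w v; rewrite /tensor_mul /tensor_lift -big_split /=.
by apply: eq_bigr => u _; apply: tensor_mullD.
Qed.

Fact tensor_mulC : commutative tensor_mul.
Proof.
move=> z w; elim/tensor_ind: z => [|z z' IHz IHz'|x y].
- by rewrite tensor_mul0l tensor_mul0r.
- by rewrite tensor_mulDl tensor_mulDr IHz IHz'.
elim/tensor_ind: w => [|w w' IHw IHw'|x' y'].
- by rewrite tensor_mul0l tensor_mul0r.
- by rewrite tensor_mulDl tensor_mulDr IHw IHw'.
by rewrite !tensor_mul_tens (mulrC x) (mulrC y).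
Qed.

Fact tensor_mul1 : left_id (tens 1 1) tensor_mul.
Proof.
elim/tensor_ind => [|z z' IHz IHz'|x y]; first exact: tensor_mul0r.
- by rewrite tensor_mulDr IHz IHz'.
by rewrite tensor_mul_tens !mul1r.
Qed.

Fact tensor_mulA : associative tensor_mul.
Proof.
move=> z w v; elim/tensor_ind: z => [|z z' IHz IHz'|x y].
- by rewrite !tensor_mul0l.
- by rewrite !tensor_mulDl IHz IHz'.
elim/tensor_ind: w => [|w w' IHw IHw'|x' y'].
- by rewrite tensor_mul0l !tensor_mul0r tensor_mul0l.
- by rewrite tensor_mulDl !tensor_mulDr tensor_mulDl IHw IHw'.
elim/tensor_ind: v => [|v v' IHv IHv'|x'' y''].
- by rewrite !tensor_mul0r.
- by rewrite !tensor_mulDr IHv IHv'.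
by rewrite !tensor_mul_tens !mulrA.
Qed.

HB.instance Definition _ := GRing.Zmodule_isComPzRing.Build tensor
  tensor_mulA tensor_mulC tensor_mul1 tensor_mulDl.

Lemma tensM x y x' y' : tens x y * tens x' y' = tens (x * x') (y * y').
Proof. exact: tensor_mul_tens. Qed.

Definition tensor_inl (x : A) : tensor := tens x 1.

Fact tensor_inl_zmod : zmod_morphism tensor_inl.
Proof.
by move=> x y; apply: (addIr (tensor_inl y)); rewrite -tensDl !subrK.
Qed.
Fact tensor_inl_monoid : monoid_morphism tensor_inl.
Proof. by split=> // x y; rewrite /tensor_inl tensM mulr1. Qed.

HB.instance Definition _ :=
  GRing.isZmodMorphism.Build A tensor tensor_inl tensor_inl_zmod.
HB.instance Definition _ :=
  GRing.isMonoidMorphism.Build A tensor tensor_inl tensor_inl_monoid.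

End Tensor.

Section Multiplication.
Variables (k R : comPzRingType) (f : {rmorphism k -> R}).

Definition tensor_mu : tensor f f -> R := tensor_lift (fun x y => x * y).

Lemma tensor_mu_bal : balanced f f (fun x y : R => x * y).
Proof.
by split=> *; rewrite ?mulrDl ?mulrDr // mulrCA mulrA.
Qed.

Lemma tensor_mu_tens x y : tensor_mu (tens f f x y) = x * y.
Proof. exact/tensor_lift_tens/tensor_mu_bal. Qed.

Fact tensor_mu_zmod : zmod_morphism tensor_mu.
Proof.
move=> z w; apply: (addIr (tensor_mu w)).
by rewrite -(tensor_liftD tensor_mu_bal) !subrK.
Qed.

HB.instance Definition _ :=
  GRing.isZmodMorphism.Build (tensor f f) R tensor_mu tensor_mu_zmod.

Fact tensor_mu_monoid : monoid_morphism tensor_mu.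
Proof.
split=> [|z w]; first by rewrite tensor_mu_tens mulr1.
elim/tensor_ind: z => [|z z' IHz IHz'|x y]; first by rewrite !(mul0r, raddf0).
- by rewrite mulrDl !raddfD mulrDl /= IHz IHz'.
elim/tensor_ind: w => [|w w' IHw IHw'|x' y']; first by rewrite !(mulr0, raddf0).
- by rewrite mulrDr !raddfD mulrDr /= IHw IHw'.
by rewrite tensM !tensor_mu_tens mulrACA.
Qed.

HB.instance Definition _ :=
  GRing.isMonoidMorphism.Build (tensor f f) R tensor_mu tensor_mu_monoid.

End Multiplication.

Section Frobenius.
Variables (p : nat) (R : comPzRingType) (chR : has_char p R).

Definition F_finite :=
  exists2 e, (0 < e)%N & exists s : seq (Fpush chR e), lin_span s = setT.

Definition is_F_splitting e (phi : {linear Fpush chR e -> R^o}) :=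
  (0 < e)%N /\ phi (Fstar chR e 1) = 1.

Definition strongly_F_regular :=
  [/\ F_finite, is_reduced R, noetherian R &
      forall d : R, Rcirc d ->
        exists2 e, (0 < e)%N &
        exists phi : {linear Fpush chR e -> R^o}, phi (Fstar chR e d) = 1].

Section TestIdeal.
Variables (RR : realType) (a : set R) (t : RR).

(** The exponent [ceil (t (p^e - 1))], a natural number since [t >= 0]. *)
Definition test_exponent (e : nat) : nat := `|Num.ceil (t * (p%:R ^+ e - 1))|%N.

Definition test_image (c : R) e (phi : {linear Fpush chR e -> R^o}) : set R :=
  [set phi (Fstar chR e (c * x)) | x in ideal_pow a (test_exponent e)].

Definition is_test_element (c : R) :=
  Rcirc c /\
  forall d, Rcirc d ->
    exists2 e, (0 < e)%N &
    exists phi : {linear Fpush chR e -> R^o}, test_image d phi c.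

Definition test_sum (c : R) : set R :=
  add_span [set x | exists2 e, (0 < e)%N &
                    exists phi : {linear Fpush chR e -> R^o}, test_image c phi x].

(** The ideal [test_sum c] does not depend on the test element [c], so this is
    [test_sum c] for any one of them. *)
Definition test_ideal : set R :=
  [set x | exists2 c, is_test_element c & test_sum c x].

End TestIdeal.
End Frobenius.

Section Diagonal.
Variables (p : nat) (k R : comPzRingType) (f : {rmorphism k -> R}).
Variable chR : has_char p R.

Let chT : has_char p (tensor f f) := has_char_rmorph (tensor_inl f f) chR.

Definition diag_cartier2 e (psi : {linear Fpush chR e -> R^o}) :=
  exists psihat : {linear Fpush chT e -> (tensor f f)^o},
    forall z : tensor f f,
      tensor_mu (psihat (Fstar chT e z)) = psi (Fstar chR e (tensor_mu z)).

Definition diag_F_split2 :=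
  exists e (psi : {linear Fpush chR e -> R^o}),
    diag_cartier2 psi /\ is_F_splitting psi.

End Diagonal.

(* Main.v *)
(** Choose c in a ∩ R°: since R is strongly F-regular, c^m is a test element
    of (R, a^u) for m >= u, and if u p^e <= N then every phi in Hom(F^e_* R, R) maps
    F^e_* a^N into tau(a^u).

    Splittings with a lift to R (x)_k R compose, so there is one, psi with lift
    Psi, of degree e so large that N = ceil(u p^e) and M = ceil(v p^e) satisfy
    N + M <= n p^e, where u = s - eps, v = t - eps and n = s + t. For x in a^n
    write x^(p^e) as a sum of products y z with y in a^N and z in a^M; then
    x = psi(F^e_* x^(p^e)) is the sum of the mu(Psi(F^e_*(y (x) z))).

    Contracting one factor of Psi(F^e_*(- (x) z)) with a k-linear functional on R
    gives an element of Hom(F^e_* R, R), and likewise in the other variable. So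
    all left contractions of w = Psi(F^e_*(y (x) z)) lie in I = tau(a^u) and all
    right ones in J = tau(a^v). The entries of a shortest expression of w as a
    sum of pure tensors are themselves such contractions, so mu(w) is in I J. *)

Require Import Defs.
From HB Require Import structures.
From mathcomp Require Import all_boot all_order all_algebra.
From mathcomp Require Import boolp classical_sets reals.

Set Implicit Arguments.
Unset Strict Implicit.
Unset Printing Implicit Defensive.

Import Order.TTheory GRing.Theory Num.Theory.
Local Open Scope classical_set_scope.
Local Open Scope ring_scope.

(** * Zorn's lemma for nonempty chains of sets *)

(** [Zorn_bigcup] also tests the empty chain, whose union is empty; adjoining [set0] to [P] handles
    that case. *)
Lemma Zorn_bigcup_from (T : Type) (P : set (set T)) (A0 : set T) :
  P A0 ->
  (forall F, F `<=` P -> F !=set0 -> total_on F subset ->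
     P (\bigcup_(X in F) X)) ->
  exists2 A, P A & forall B, P B -> A `<=` B -> B = A.
Proof.
move=> PA0 Pchain.
have [F FP Ftot|A [PA maxA]] := @Zorn_bigcup T [set X | X = set0 \/ P X].
  pose F' := F `&` P.
  have [/set0P F'0|F'0] := boolP (F' != set0); last first.
    left; rewrite -subset0 => x [X FX Xx].
    case: (FP _ FX) => [X0|PX]; first by rewrite X0 in Xx.
    have : F' X by [].
    by move: F'0; rewrite negbK => /eqP ->.
  right; have -> : \bigcup_(X in F) X = \bigcup_(X in F') X.
    rewrite eqEsubset; split=> x [X FX Xx]; last by case: FX => FX _; exists X.
    exists X => //; split=> //; case: (FP _ FX) => // X0.
    by rewrite X0 in Xx.
  by apply: Pchain => // [X [] //|X Y [FX _] [FY _]]; apply: Ftot.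
have max B : P B -> A `<=` B -> B = A.
  move=> PB AB; rewrite eqEsubset; split=> //; apply: contrapT => BA.
  by apply: (maxA B); [split | right].
case: PA => [A_0|PA]; last by exists A.
(* If the maximal set is the adjoined [set0], maximality forces [A0] to be empty too, so [P] holds
   there anyway. *)
exists A => //; rewrite A_0 -(_ : A0 = set0) //.
by rewrite -A_0; apply: max => //; rewrite A_0.
Qed.

(** * Minimal primes of a noetherian ring and prime avoidance *)

Section Noetherian.
Variable R : comPzRingType.
Implicit Types (I P Q : set R) (l : seq (set R)).

Lemma ideal_sum I (T : Type) (r : seq T) (D : pred T) (F : T -> R) : is_ideal I ->
  (forall i, D i -> I (F i)) -> I (\sum_(i <- r | D i) F i).
Proof. by case=> I0 ID _ IF; apply: big_ind. Qed.

Lemma lin_span_sub I (s : seq R^o) : is_ideal I ->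
  lin_span s `<=` I <-> {in s, forall y, I y}.
Proof.
move=> idI; split=> [sI y ys|sI _ [c ->]].
  have ys' : (index y s < size s)%N by rewrite index_mem.
  apply: sI; exists (fun i => (i == Ordinal ys')%:R).
  rewrite (bigD1 (Ordinal ys')) //= eqxx scale1r nth_index // big1 ?addr0 //.
  by move=> i /negPf ->; rewrite scale0r.
apply: ideal_sum => // i _; case: idI => _ _ IM; apply: IM.
exact/sI/mem_nth.
Qed.

(** The union of a chain is a finitely generated ideal; its generators already lie in one member of
    the chain, so the union equals that member. *)
Lemma noetherian_maximal (Fam : set (set R)) : noetherian R ->
  (forall I, Fam I -> is_ideal I) -> Fam !=set0 ->
  exists2 I, Fam I & forall J, Fam J -> I `<=` J -> J = I.
Proof.
move=> noethR Fam_id [I0 FI0]; apply: (Zorn_bigcup_from FI0).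
move=> F FFam [X0 FX0] Ftot; set U := \bigcup_(X in F) X.
have idF X : F X -> is_ideal X by move=> /FFam/Fam_id.
have idU : is_ideal U.
  split; first by exists X0 => //; case: (idF _ FX0).
    move=> x y [X FX Xx] [Y FY Yy].
    case: (Ftot _ _ FX FY) => XY; [exists Y => // | exists X => //];
      [case: (idF _ FY) | case: (idF _ FX)] => _ D _; apply: D => //; exact: XY.
  by move=> r x [X FX Xx]; exists X => //; case: (idF _ FX) => _ _; apply.
have [s Us] := noethR _ idU.
have sU : {in s, forall y, U y}.
  by apply/(lin_span_sub s idU); rewrite -Us.
have [X FX sX] : exists2 X, F X & {in s, forall y, X y}.
  elim: s {Us} sU => [|y s IHs] sU; first by exists X0.
  have [|X FX sX] := IHs; first by move=> z zs; apply: sU; rewrite inE zs orbT.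
  have [Y FY Yy] := sU y (mem_head _ _).
  case: (Ftot _ _ FX FY) => XY; [exists Y | exists X] => // z; rewrite inE;
    case/predU1P=> [->|/sX] //; exact: XY.
suff -> : U = X by apply: FFam.
rewrite eqEsubset; split=> [x|x Xx]; last by exists X.
by rewrite Us; apply: (proj2 (lin_span_sub s (idF _ FX))).
Qed.

(** This is the ideal [I + R x]. *)
Definition ideal_adjoin I (x : R) : set R := [set z | exists r, I (z - r * x)].

Lemma ideal_adjoinP I x : is_ideal I ->
  [/\ is_ideal (ideal_adjoin I x), I `<=` ideal_adjoin I x &
      ideal_adjoin I x x].
Proof.
case=> I0 ID IM; split.
- split; first by exists 0; rewrite mul0r subr0.
    move=> y z [r Ir] [r' Ir']; exists (r + r').
    by rewrite mulrDl opprD addrACA; apply: ID.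
  move=> c y [r Ir]; exists (c * r); rewrite -mulrA -mulrBr; exact: IM.
- by move=> y Iy; exists 0; rewrite mul0r subr0.
by exists 1; rewrite mul1r subrr.
Qed.

Lemma adjoin_sub_prime I P x : is_ideal P -> I `<=` P -> P x ->
  ideal_adjoin I x `<=` P.
Proof.
move=> [_ PD PM] IP Px z [r Iz].
by rewrite -(subrK (r * x) z); apply: PD; [apply: IP | apply: PM].
Qed.

(** Noetherian induction: let [J] be maximal among the ideals without such a list. It is proper, or
    the empty list would do. It is prime: if [x y] is in [J] with [x] and [y] outside, a prime above
    [J] contains [J + R x] or [J + R y], and the lists of these two larger ideals can be
    concatenated. But then [[:: J]] is a list for [J]. *)
Lemma noetherian_primes_above : noetherian R -> forall I, is_ideal I ->
  exists2 l : seq (set R), {in l, forall P, is_prime_ideal P} &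
    forall Q, is_prime_ideal Q -> I `<=` Q -> exists2 P, P \in l & P `<=` Q.
Proof.
move=> noethR I idI.
pose G J := exists2 l : seq (set R), {in l, forall P, is_prime_ideal P} &
    forall Q, is_prime_ideal Q -> J `<=` Q -> exists2 P, P \in l & P `<=` Q.
apply: contrapT => nGI.
have [||J [idJ nGJ] maxJ] :=
  @noetherian_maximal [set J | is_ideal J /\ ~ G J] noethR.
- by move=> J [].
- by exists I.
have GJ K : is_ideal K -> J `<=` K -> K <> J -> G K.
  by move=> idK JK KJ; apply: contrapT => nGK; apply/KJ/maxJ.
have nJ1 : ~ J 1.
  by move=> J1; apply: nGJ; exists [::] => // Q [_ nQ1 _] /(_ _ J1).
apply: (nGJ); exists [:: J]; last first.
  by move=> Q prQ JQ; exists J; rewrite ?mem_head.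
move=> _ /predU1P[->|//]; split=> // x y Jxy.
apply: contrapT => /not_orP[nJx nJy].
have GJx z : ~ J z -> G (ideal_adjoin J z).
  move=> nJz; have [idJz sJz Jzz] := ideal_adjoinP z idJ.
  by apply: GJ => // JJ; rewrite JJ in Jzz.
have [lx prlx minlx] := GJx _ nJx; have [ly prly minly] := GJx _ nJy.
case: nGJ; exists (lx ++ ly).
  by move=> P /[!mem_cat]/orP[/prlx|/prly].
move=> Q prQ JQ; have [idQ _ QM] := prQ.
case: (QM _ _ (JQ _ Jxy)) => [Qx|Qy].
  have [|P Plx PQ] := minlx _ prQ; first exact: adjoin_sub_prime.
  by exists P => //; rewrite mem_cat Plx.
have [|P Ply PQ] := minly _ prQ; first exact: adjoin_sub_prime.
by exists P => //; rewrite mem_cat Ply orbT.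
Qed.

Lemma noetherian_finite_minimal_primes : noetherian R ->
  exists l, forall P, is_minimal_prime P <-> P \in l.
Proof.
move=> noethR.
have id0 : is_ideal [set (0 : R)].
  split=> //= [x y -> ->|r x ->]; [exact: addr0 | exact: mulr0].
have [l prl minl] := noetherian_primes_above noethR id0.
exists [seq P <- l | `[< is_minimal_prime P >]] => P.
rewrite mem_filter; split=> [minP|/andP[/asboolP//]].
apply/andP; split; first exact/asboolP.
have [|Q Ql QP] := minl _ (proj1 minP).
  by move=> _ ->; case: minP => [[[]]].
by rewrite -(proj2 minP Q) //; apply: prl.
Qed.

(** Multiply elements outside [P], one taken from [a] and one from each [Q] in [l]; the product
    stays outside because [P] is prime. *)
Lemma exists_outside_prime (a P : set R) l : is_ideal a -> is_prime_ideal P ->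
  ~ a `<=` P -> {in l, forall Q, is_ideal Q /\ ~ Q `<=` P} ->
  exists2 z, a z /\ {in l, forall Q, Q z} & ~ P z.
Proof.
move=> ida [_ _ PM] naP; elim: l => [|Q l IHl] hl.
  have /existsNP[z /not_implyP[az nPz]] := naP.
  by exists z.
have [|z [az zl] nPz] := IHl; first by move=> Q' Ql; apply: hl; rewrite inE Ql orbT.
have [idQ /existsNP[q /not_implyP[Qq nPq]]] := hl Q (mem_head _ _).
exists (q * z); last by case/PM.
split; first by case: ida => _ _; apply.
move=> Q'; rewrite inE => /predU1P[->|Q'l].
  by rewrite mulrC; case: idQ => _ _; apply.
have [[_ _ Q'M] _] : is_ideal Q' /\ ~ Q' `<=` P by apply: hl; rewrite inE Q'l orbT.
by apply: Q'M; apply: zl.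
Qed.

Lemma minimal_prime_avoidance (a : set R) : noetherian R -> is_ideal a ->
  (forall P, is_minimal_prime P -> ~ a `<=` P) -> exists2 c, a c & Rcirc c.
Proof.
move=> noethR ida naP.
have [l0 minl0] := noetherian_finite_minimal_primes noethR.
suff [c ac cl] : exists2 c, a c & {in l0, forall P : set R, ~ P c}.
  by exists c => // P /minl0/cl.
have : {in l0, forall P, is_minimal_prime P} by move=> P /minl0.
elim: l0 {minl0} => [|P l IHl] minl; first by case: ida => a0 _ _; exists 0.
have [|c ac cl] := IHl; first by move=> Q Ql; apply: minl; rewrite inE Ql orbT.
have [Pl|Pl] := boolP (P \in l).
  by exists c => // Q; rewrite inE => /predU1P[->|]; apply: cl.
have minP := minl P (mem_head _ _).
have [nPc|/contrapT Pc] := pselect (~ P c).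
  by exists c => // Q; rewrite inE => /predU1P[->|/cl].
(* Here [c] avoids [l] but lies in [P]. With [z] in [a] and in every member of [l] but not in [P],
   the sum [c + z] avoids all of them. *)
have [| | |z [az zl] nPz] := @exists_outside_prime a P l ida.
- by case: minP.
- exact: naP.
- move=> Q Ql; have [prQ _] : is_minimal_prime Q by apply: minl; rewrite inE Ql orbT.
  split; first by case: prQ.
  (* Minimality of [P] would give [Q = P], although [P] is not in [l]. *)
  by move=> QP; move: Pl; rewrite -(proj2 minP Q) // Ql.
exists (c + z); first by case: ida => _ aD _; apply: aD.
have diff (Q : set R) x y : is_ideal Q -> Q x -> Q (x + y) -> Q y.
  case=> _ QD QM Qx Qxy; rewrite -(addKr x y); apply: QD => //.
  by rewrite -mulN1r; apply: QM.
move=> Q; rewrite inE => /predU1P[->|Ql] Qcz.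
  by apply: nPz; apply: diff Qcz => //; case: minP => [[]].
apply: (cl Q Ql); rewrite addrC in Qcz; apply: diff Qcz; last exact: zl.
have [[] //] : is_minimal_prime Q by apply: minl; rewrite inE Ql orbT.
Qed.

Lemma Rcirc_exp (c : R) m : Rcirc c -> (0 < m)%N -> Rcirc (c ^+ m).
Proof.
move=> cR; case: m => // m _ P minP; have [_ _ PM] := proj1 minP.
elim: m => [|m IHm]; first by rewrite expr1; apply: cR.
by rewrite exprS => /PM[/(cR _ minP)|].
Qed.

End Noetherian.

(** * Sums of elements and powers of ideals *)

Section IdealPowers.
Variable R : comPzRingType.
Implicit Types (I J a : set R).

Lemma add_span_in (X : set R) x : X x -> add_span X x.
Proof.
by move=> Xx; exists [:: x]; rewrite ?big_seq1 // => y /[!inE]/eqP->.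
Qed.

Lemma add_span0 (X : set R) : add_span X 0.
Proof. by exists [::]; rewrite ?big_nil. Qed.

Lemma add_spanD (X : set R) x y :
  add_span X x -> add_span X y -> add_span X (x + y).
Proof.
move=> [s sX ->] [r rX ->]; exists (s ++ r); last by rewrite big_cat.
by move=> z /[!mem_cat]/orP[/sX|/rX].
Qed.

Lemma add_span_sum (X : set R) (T : eqType) (s : seq T) (F : T -> R) :
  {in s, forall i, add_span X (F i)} -> add_span X (\sum_(i <- s) F i).
Proof.
move=> sX; rewrite big_seq; apply: big_ind => //; first exact: add_span0.
exact: add_spanD.
Qed.

Lemma add_span_ind (X P : set R) : P 0 -> (forall x y, P x -> P y -> P (x + y)) ->
  X `<=` P -> add_span X `<=` P.
Proof.
move=> P0 PD XP _ [s sX ->]; rewrite big_seq.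
by apply: big_ind => // y /sX/XP.
Qed.

Lemma ideal_pow_ideal a n : is_ideal a -> is_ideal (ideal_pow a n).
Proof.
move=> [a0 aD aM]; case: n => [|n]; first by [].
split.
- exact: add_span0.
- exact: add_spanD.
move=> r; apply: add_span_ind => [|x y|x].
- by rewrite mulr0; apply: add_span0.
- by rewrite mulrDr; apply: add_spanD.
case=> y [z [ay az ->]]; apply: add_span_in; exists (r * y), z.
by rewrite mulrA; split=> //; apply: aM.
Qed.

Lemma ideal_powD_mul a m n x y : is_ideal a ->
  ideal_pow a m x -> ideal_pow a n y -> ideal_pow a (m + n) (x * y).
Proof.
move=> ida; elim: m x y => [|m IHm] x y.
  by move=> _ ay; case: (ideal_pow_ideal n ida) => _ _; apply.
move=> /= ax ay; move: x ax; apply: add_span_ind => [|u v|_ [b [w [ab aw ->]]]].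
- by rewrite mul0r; case: (ideal_pow_ideal (m + n).+1 ida).
- by rewrite mulrDl; apply: add_spanD.
by apply: add_span_in; exists b, (w * y); rewrite mulrA; split=> //; apply: IHm.
Qed.

Lemma ideal_pow_leq a m n : is_ideal a -> (m <= n)%N ->
  ideal_pow a n `<=` ideal_pow a m.
Proof.
move=> ida; elim: m n => [//|m IHm] [//|n] mn.
apply: add_span_ind => [|u v|_ [b [w [ab aw ->]]]].
- by case: (ideal_pow_ideal m.+1 ida).
- exact: add_spanD.
by apply: add_span_in; exists b, w; split=> //; apply: IHm aw.
Qed.

Lemma ideal_pow_exp a m x j : is_ideal a -> ideal_pow a m x ->
  ideal_pow a (m * j) (x ^+ j).
Proof.
move=> ida ax; elim: j => [|j IHj]; first by rewrite muln0.
by rewrite mulnS exprS; apply: ideal_powD_mul.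
Qed.

Lemma ideal_pow1 a x : is_ideal a -> a x -> ideal_pow a 1 x.
Proof. by move=> ida ax; apply: add_span_in; exists x, 1; rewrite mulr1. Qed.

Lemma ideal_pow_split a m n : is_ideal a ->
  ideal_pow a (m + n) `<=` ideal_mul (ideal_pow a m) (ideal_pow a n).
Proof.
move=> ida; elim: m => [|m IHm] /=.
  by move=> x ax; apply: add_span_in; exists 1, x; rewrite mul1r.
apply: add_span_ind => [|u v|_ [b [w [ab /IHm aw ->]]]].
- exact: add_span0.
- exact: add_spanD.
move: w aw; apply: add_span_ind => [|u v|_ [y [z [ay az ->]]]].
- by rewrite mulr0; apply: add_span0.
- by rewrite mulrDr; apply: add_spanD.
apply: add_span_in; exists (b * y), z; rewrite mulrA; split=> //.
by apply: add_span_in; exists b, y.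
Qed.

End IdealPowers.

(** * Linear functionals over [k] and shortest expressions in the tensor square *)

Section Functionals.
Variables (k : fieldType) (R : comPzRingType) (f : {rmorphism k -> R}).
Implicit Types (S H : set R) (l : seq R).

Definition k_subspace S :=
  [/\ S 0, forall x y, S x -> S y -> S (x + y) & forall c x, S x -> S (f c * x)].

(** A subspace [H] maximal among those containing [S] and missing [y] is a hyperplane complementary
    to [f k * y]; [lam] reads off the coefficient of [y]. *)
Lemma separating_functional S y : k_subspace S -> ~ S y ->
  exists lam : R -> k,
    [/\ forall u v, lam (u + v) = lam u + lam v,
        forall c u, lam (f c * u) = c * lam u,
        forall z, S z -> lam z = 0 & lam y = 1].
Proof.
move=> subS nSy.
pose P := [set H | [/\ k_subspace H, S `<=` H & ~ H y]].
have [||H [subH SH nHy] maxH] := @Zorn_bigcup_from _ P S.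
- by split.
- move=> F FP [X0 FX0] Ftot; split; last by move=> [X /FP[_ _ nX] /nX].
    split; first by exists X0 => //; case: (FP _ FX0) => [[]].
      move=> u v [X FX Xu] [Y FY Yv].
      case: (Ftot _ _ FX FY) => XY; [exists Y => // | exists X => //];
       [case: (FP _ FY) | case: (FP _ FX)] => - [_ D _] _ _;
        apply: D => //; exact: XY.
    move=> c u [X FX Xu]; exists X => //.
    by case: (FP _ FX) => [[_ _ M] _ _]; apply: M.
  by move=> z Sz; exists X0 => //; case: (FP _ FX0) => _ /(_ _ Sz).
have [H0 HD HM] := subH.
have HN u : H u -> H (- u) by rewrite -mulN1r -(rmorphN1 f); apply: HM.
(* For [r] outside [H], maximality puts [y] in [H + k r]. The coefficient of [r] is nonzero since
   [y] is not in [H], so the relation can be solved for [r]. *)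
have Hex r : exists c, H (r - f c * y).
  have [Hr|nHr] := pselect (H r); first by exists 0; rewrite rmorph0 mul0r subr0.
  pose B := [set z | exists c, H (z - f c * r)].
  have HB : H `<=` B by move=> z Hz; exists 0; rewrite rmorph0 mul0r subr0.
  have Br : B r by exists 1; rewrite rmorph1 mul1r subrr.
  have [[c Hc]|nBy] := pselect (B y); last first.
    suff HE : B = H by rewrite HE in Br.
    apply: maxH => //; split=> //; last by move=> z /SH/HB.
    split; first exact: HB.
      move=> u v [c Hc] [d Hd]; exists (c + d).
      by rewrite rmorphD mulrDl opprD addrACA; apply: HD.
    by move=> c u [d Hd]; exists (c * d); rewrite rmorphM -mulrA -mulrBr; apply: HM.
  have c0 : c != 0.
    by apply: contra_not_neq nHy => c0; move: Hc; rewrite c0 rmorph0 mul0r subr0.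
  exists c^-1; rewrite -opprB; apply: HN.
  rewrite (_ : _ - r = f c^-1 * (y - f c * r)); first exact: HM.
  by rewrite mulrBr mulrA -rmorphM mulVf // rmorph1 mul1r.
have Huniq r c d : H (r - f c * y) -> H (r - f d * y) -> c = d.
  move=> Hc Hd; apply/eqP; rewrite -subr_eq0; apply: contra_notT nHy => cd0.
  rewrite -[y]mul1r -(rmorph1 f) -(mulVf cd0) rmorphM -mulrA; apply: HM.
  rewrite (_ : _ * y = (r - f d * y) + - (r - f c * y)).
    by apply: HD => //; apply: HN.
  by rewrite rmorphB mulrBl opprB [RHS]addrC addrA subrK.
have [lam lamP] := choice Hex.
exists lam; split.
- move=> u v; apply: (Huniq (u + v)); first exact: lamP.
  by rewrite rmorphD mulrDl opprD addrACA; apply: HD.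
- move=> c u; apply: (Huniq (f c * u)); first exact: lamP.
  by rewrite rmorphM -mulrA -mulrBr; apply: HM.
- move=> z /SH Hz; apply: (Huniq z); first exact: lamP.
  by rewrite rmorph0 mul0r subr0.
apply: (Huniq y); first exact: lamP.
by rewrite rmorph1 mul1r subrr.
Qed.

Fixpoint k_span l : set R :=
  if l is v :: l' then [set z | exists c, k_span l' (z - f c * v)] else [set 0].

Lemma k_span_subspace l : k_subspace (k_span l).
Proof.
elim: l => [|v l [S0 SD SM]] /=.
  split=> //= [x y -> ->|c x ->]; [exact: addr0 | exact: mulr0].
split; first by exists 0; rewrite rmorph0 mul0r subr0.
  move=> x y [c Sc] [d Sd]; exists (c + d).
  by rewrite rmorphD mulrDl opprD addrACA; apply: SD.
by move=> c u [d Sd]; exists (c * d); rewrite rmorphM -mulrA -mulrBr; apply: SM.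
Qed.

Lemma mem_k_span l z : z \in l -> k_span l z.
Proof.
elim: l => //= v l IHl; have [S0 _ _] := k_span_subspace l.
rewrite inE => /predU1P[->|/IHl Sz].
  by exists 1; rewrite rmorph1 mul1r subrr.
by exists 0; rewrite rmorph0 mul0r subr0.
Qed.

Local Notation T := (tensor f f).
Local Notation "x ⊗ y" := (tens f f x y) (at level 40).
Implicit Types (w : T) (s : seq (R * R)).

Definition tsum s : T := \sum_(u <- s) u.1 ⊗ u.2.

Lemma tens0r x : x ⊗ 0 = 0.
Proof. by apply: (addIr (x ⊗ 0)); rewrite -tensDr !add0r. Qed.

(** If [y] has component [c v] along an entry [v], then [x ⊗ c v] merges with [u ⊗ v] into
    [(c x + u) ⊗ v], so no new term is needed. *)
Lemma tsum_absorb s x y : k_span [seq u.2 | u <- s] y ->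
  exists2 s', size s' = size s & x ⊗ y + tsum s = tsum s'.
Proof.
rewrite /tsum; elim: s x y => [|[u v] s IHs] x y /=.
  by move=> ->; exists [::]; rewrite // tens0r add0r.
case=> c /(IHs x)[s' szs' Es'].
exists ((f c * x + u, v) :: s'); rewrite /= ?szs' // !big_cons -Es' /=.
by rewrite tensDl tensZ addrACA -tensDr [f c * v + _]addrC subrK.
Qed.

Definition minimal_repr w s :=
  w = tsum s /\ forall s', w = tsum s' -> (size s <= size s')%N.

Lemma minimal_reprP w : exists s, minimal_repr w s.
Proof.
pose P n := `[< exists2 s, size s = n & w = tsum s >].
have exP : exists n, P n.
  exists (size (repr w)); apply/asboolP; exists (repr w) => //.
  by rewrite /tsum -tensor_piE tensor_reprK.
case: (ex_minnP exP) => n /asboolP[s <- ws] minn; exists s; split=> // s' ws'.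
by apply: minn; apply/asboolP; exists s'.
Qed.

(** This is [id ⊗ lam], followed by the identification of [R ⊗ k] with [R]. *)
Definition contract_r (lam : R -> k) : T -> R :=
  tensor_lift (fun x y => f (lam y) * x).

Section Contract.
Variable lam : R -> k.
Hypothesis lamD : forall u v, lam (u + v) = lam u + lam v.
Hypothesis lamZ : forall c u, lam (f c * u) = c * lam u.

Lemma contract_r_bal : balanced f f (fun x y => f (lam y) * x).
Proof.
split=> [x x' y|x y y'|c x y]; first exact: mulrDr.
- by rewrite lamD rmorphD mulrDl.
by rewrite lamZ rmorphM mulrA (mulrC (f c)).
Qed.

Lemma contract_rD : {morph contract_r lam : z w / z + w}.
Proof. exact/tensor_liftD/contract_r_bal. Qed.

Lemma contract_r_tens x y : contract_r lam (x ⊗ y) = f (lam y) * x.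
Proof. exact/tensor_lift_tens/contract_r_bal. Qed.

Lemma contract_r0 : contract_r lam 0 = 0.
Proof. exact/tensor_lift0/contract_r_bal. Qed.

Lemma contract_r_mull r w : contract_r lam (r ⊗ 1 * w) = r * contract_r lam w.
Proof.
elim/tensor_ind: w => [|z w IHz IHw|x y]; first by rewrite mulr0 contract_r0 mulr0.
- by rewrite mulrDr !contract_rD mulrDr IHz IHw.
by rewrite tensM mul1r !contract_r_tens mulrCA.
Qed.

End Contract.

(** By [tsum_absorb] and minimality, [u.2] is not in the span of the other second entries. A
    functional equal to 1 at [u.2] and vanishing on that span isolates [u.1]. *)
Lemma minimal_repr_dual w s u : minimal_repr w s -> u \in s ->
  exists lam : R -> k,
    [/\ forall x y, lam (x + y) = lam x + lam y,
        forall c x, lam (f c * x) = c * lam x & contract_r lam w = u.1].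
Proof.
move=> [ws mins] us; have ps := perm_to_rem us; set s' := rem u s in ps.
have wE : w = u.1 ⊗ u.2 + tsum s' by rewrite ws /tsum (perm_big _ ps) big_cons.
have nspan : ~ k_span [seq v.2 | v <- s'] u.2.
  case/(@tsum_absorb _ u.1 _) => s'' szs'' E; move: (mins s'').
  by rewrite wE -E => /(_ erefl); rewrite (perm_size ps) szs'' /= ltnn.
have [lam [lamD lamZ lam0 lam1]] := separating_functional (k_span_subspace _) nspan.
exists lam; split=> //.
rewrite wE contract_rD // contract_r_tens // lam1 rmorph1 mul1r.
suff -> : contract_r lam (tsum s') = 0 by rewrite addr0.
(* The induction shortens the list being summed, while the span killed by [lam] remains that of all
   of [s']. *)
rewrite /tsum; have : {subset s' <= s'} by [].
elim: {1 3}s' => [|v r IHr] sub; first by rewrite big_nil contract_r0.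
rewrite big_cons contract_rD // contract_r_tens // IHr ?addr0; last first.
  by move=> z zr; apply: sub; rewrite inE zr orbT.
rewrite lam0 ?rmorph0 ?mul0r //; apply/mem_k_span/map_f/sub/mem_head.
Qed.

(** Swapping the factors makes [contract_r] and [minimal_repr_dual] available for first entries as
    well. *)
Definition tswap : T -> T := tensor_lift (fun x y => y ⊗ x).

Lemma tswap_bal : balanced f f (fun x y => y ⊗ x).
Proof. by split=> *; rewrite ?tensDl ?tensDr // tensZ. Qed.

Lemma tswapD : {morph tswap : z w / z + w}.
Proof. exact/tensor_liftD/tswap_bal. Qed.

Lemma tswap_tens x y : tswap (x ⊗ y) = y ⊗ x.
Proof. exact/tensor_lift_tens/tswap_bal. Qed.

Lemma tswap0 : tswap 0 = 0.
Proof. exact/tensor_lift0/tswap_bal. Qed.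

Lemma tswapK : involutive tswap.
Proof.
elim/tensor_ind=> [|z w IHz IHw|x y]; first by rewrite !tswap0.
- by rewrite !tswapD IHz IHw.
by rewrite !tswap_tens.
Qed.

Lemma tswapM : {morph tswap : z w / z * w}.
Proof.
move=> z w; elim/tensor_ind: z => [|z z' IHz IHz'|x y]; first by rewrite !(mul0r, tswap0).
- by rewrite mulrDl !tswapD mulrDl IHz IHz'.
elim/tensor_ind: w => [|w w' IHw IHw'|x' y']; first by rewrite !(mulr0, tswap0).
- by rewrite mulrDr !tswapD mulrDr IHw IHw'.
by rewrite tensM !tswap_tens tensM.
Qed.

Lemma tswap_tsum s : tswap (tsum s) = tsum [seq (u.2, u.1) | u <- s].
Proof.
rewrite /tsum big_map; elim: s => [|u s IHs]; first by rewrite !big_nil tswap0.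
by rewrite !big_cons tswapD IHs tswap_tens.
Qed.

Lemma minimal_repr_swap w s : minimal_repr w s ->
  minimal_repr (tswap w) [seq (u.2, u.1) | u <- s].
Proof.
case=> -> mins; split; first by rewrite tswap_tsum.
move=> s' /(congr1 tswap); rewrite tswapK tswap_tsum => /mins.
by rewrite !size_map.
Qed.

(* (I ⊗ R) ∩ (R ⊗ J) = I ⊗ J, the two factors on the left being
   tested by contraction against linear functionals. *)
Lemma tensor_mu_contract w (I J : set R) :
  (forall lam, (forall x y, lam (x + y) = lam x + lam y) ->
     (forall c x, lam (f c * x) = c * lam x) -> I (contract_r lam w)) ->
  (forall lam, (forall x y, lam (x + y) = lam x + lam y) ->
     (forall c x, lam (f c * x) = c * lam x) -> J (contract_r lam (tswap w))) ->
  ideal_mul I J (tensor_mu w).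
Proof.
move=> Iw Jw; have [s mins] := minimal_reprP w.
rewrite (proj1 mins) raddf_sum; apply: add_span_sum => u us.
apply: add_span_in; exists u.1, u.2; split; last exact: tensor_mu_tens.
  by have [lam [lamD lamZ <-]] := minimal_repr_dual mins us; apply: Iw.
have us' : (u.2, u.1) \in [seq (u.2, u.1) | u <- s] by apply/mapP; exists u.
have [lam [lamD lamZ /= <-]] := minimal_repr_dual (minimal_repr_swap mins) us'.
exact: Jw.
Qed.

End Functionals.

(** * Maps on Frobenius pushforwards and their composition *)

Lemma linear_Fstar_exp (p : nat) (A : comPzRingType) (chA : has_char p A) e
    (phi : {linear Fpush chA e -> A^o}) r x :
  phi (Fstar chA e (r ^+ (p ^ e) * x)) = r * phi (Fstar chA e x).
Proof. by rewrite -Fpush_scaleE linearZ. Qed.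

Section FrobeniusComposition.
Variables (p : nat) (A : comPzRingType) (chA : has_char p A) (e1 e2 : nat).
Variables (phi1 : {linear Fpush chA e1 -> A^o}) (phi2 : {linear Fpush chA e2 -> A^o}).

(** This is the composite of [phi1] with the pushforward of [phi2] along [F^e1], the product in the
    Cartier algebra. *)
Definition Fcomp (y : Fpush chA (e1 + e2)) : A^o :=
  phi1 (Fstar chA e1 (phi2 (Fstar chA e2 y))).

Fact Fcomp_zmod : zmod_morphism Fcomp.
Proof. by move=> x y; rewrite /Fcomp /Fstar !raddfB. Qed.

Fact Fcomp_scalable : scalable Fcomp.
Proof.
move=> r y; rewrite /Fcomp.
have -> : Fstar chA e2 (r *: y) = r ^+ (p ^ e1) *: Fstar chA e2 y.
  by rewrite (Fpush_scaleE chA e2) -exprM -expnD.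
rewrite linearZ; exact: linear_Fstar_exp.
Qed.

HB.instance Definition _ :=
  GRing.isZmodMorphism.Build (Fpush chA (e1 + e2)) A^o Fcomp Fcomp_zmod.
HB.instance Definition _ :=
  GRing.isScalable.Build A (Fpush chA (e1 + e2)) A^o *:%R Fcomp Fcomp_scalable.

Definition Fcomp_linear : {linear Fpush chA (e1 + e2) -> A^o} := Fcomp.

Lemma Fcomp_linearE x : Fcomp_linear (Fstar chA (e1 + e2) x) =
  phi1 (Fstar chA e1 (phi2 (Fstar chA e2 x))).
Proof. by []. Qed.

End FrobeniusComposition.

(** * Test elements and test ideals under strong F-regularity *)

Section TestIdeals.
Variables (p : nat) (R : comPzRingType) (chR : has_char p R) (RR : realType).
Variables (a : set R) (ida : is_ideal a) (u : RR) (u0 : 0 <= u).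

(** Replacing [p ^ e - 1] by [p ^ e] gives a bound that survives multiplication by further powers of
    [p]. The absolute value is harmless: the ceiling is nonnegative because [p ^ e >= 1]. *)
Lemma test_exponent_le e N : u * p%:R ^+ e <= N%:R -> (test_exponent p u e <= N)%N.
Proof.
move=> uN; rewrite /test_exponent -lez_nat gez0_abs.
  rewrite ceil_le_int; apply: le_trans uN.
  by rewrite ler_wpM2l // gerBl.
rewrite ceil_ge0 (lt_le_trans (ltrN10 _)) // mulr_ge0 // subr_ge0.
rewrite exprn_ege1 // ler1n.
by case/andP: chR => /prime_gt0.
Qed.

Lemma Rcirc_test_element c m : strongly_F_regular chR -> a c -> Rcirc c ->
  (0 < m)%N -> u <= m%:R -> is_test_element chR a u (c ^+ m).
Proof.
move=> [_ _ _ regR] ac cR m0 um; split; first exact: Rcirc_exp.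
move=> d dR; have [e e0 [phi phid]] := regR d dR; exists e => //.
(* This power leaves [phi] as the factor [c ^+ m], and it lies in [a ^ (m p^e)], deep enough since
   [u <= m]. *)
exists phi, ((c ^+ m) ^+ (p ^ e)); last first.
  by rewrite mulrC linear_Fstar_exp phid mulr1.
rewrite -exprM; have := ideal_pow_exp (m * p ^ e) ida (ideal_pow1 ida ac).
rewrite mul1n; apply: ideal_pow_leq => //; apply: test_exponent_le.
by rewrite natrM natrX ler_wpM2r // exprn_ge0.
Qed.

(* Strong F-regularity provides [theta] with [theta (F_* c) = 1]; then
   [y = theta (F_* (c y ^ (p ^ e')))], so that [phi (F_* y)] is one of the
   generators of the test ideal, for the map [phi \o F_* theta]. *)
Lemma test_ideal_linear e (phi : {linear Fpush chR e -> R^o}) c N y :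
  strongly_F_regular chR -> is_test_element chR a u c ->
  u * p%:R ^+ e <= N%:R -> ideal_pow a N y ->
  test_ideal chR a u (phi (Fstar chR e y)).
Proof.
move=> [_ _ _ regR] testc uN ay; exists c => //.
have [e' e'0 [theta thetac]] := regR c (proj1 testc).
apply: add_span_in; exists (e + e')%N; first by rewrite addn_gt0 e'0 orbT.
exists (Fcomp_linear phi theta), (y ^+ (p ^ e')); last first.
  by rewrite Fcomp_linearE mulrC linear_Fstar_exp thetac mulr1.
have := ideal_pow_exp (p ^ e') ida ay.
apply: ideal_pow_leq => //; apply: test_exponent_le.
by rewrite natrM natrX exprD mulrA ler_wpM2r // exprn_ge0.
Qed.

End TestIdeals.

(** * Contracting a map on the tensor square to maps on [R] *)

Section DiagonalLift.
Variables (p : nat) (k : fieldType) (R : comPzRingType) (f : {rmorphism k -> R}).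
Variable chR : has_char p R.
Local Notation T := (tensor f f).
Variables (chT : has_char p T) (e : nat) (Psi : {linear Fpush chT e -> T^o}).
Variable lam : R -> k.
Hypothesis lamD : forall u v, lam (u + v) = lam u + lam v.
Hypothesis lamZ : forall c u, lam (f c * u) = c * lam u.

Definition slice_l (z : R) (y : Fpush chR e) : R^o :=
  contract_r lam (Psi (Fstar chT e (tens f f y z))).

Fact slice_l_zmod z : zmod_morphism (slice_l z).
Proof.
move=> x y; apply: (addIr (slice_l z y)); rewrite subrK /slice_l.
apply: (etrans (esym (contract_rD lamD lamZ _ _))).
by rewrite -raddfD /= -FstarD -tensDl subrK.
Qed.

Lemma tens_exp (x y : R) n : tens f f x y ^+ n = tens f f (x ^+ n) (y ^+ n).
Proof. by elim: n => [//|n IHn]; rewrite !exprS IHn tensM. Qed.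

(** Scaling [y] multiplies [y ⊗ z] by the [p ^ e]-th power of [r ⊗ 1]; [Psi] releases [r ⊗ 1], and
    contracting the second factor is linear over the first. *)
Fact slice_l_scalable z : scalable (slice_l z).
Proof.
move=> r y; rewrite /slice_l.
have -> : tens f f (r *: y) z = tens f f r 1 ^+ (p ^ e) * tens f f y z.
  by rewrite tens_exp tensM expr1n mul1r.
by rewrite linear_Fstar_exp contract_r_mull.
Qed.

HB.instance Definition _ z :=
  GRing.isZmodMorphism.Build (Fpush chR e) R^o (slice_l z) (slice_l_zmod z).
HB.instance Definition _ z :=
  GRing.isScalable.Build R (Fpush chR e) R^o *:%R (slice_l z) (slice_l_scalable z).

Definition slice_l_linear z : {linear Fpush chR e -> R^o} := slice_l z.

(** After the swap, [lam] consumes the first factor of the value of [Psi], leaving the factor on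
    which scaling [y] acts. *)
Definition slice_r (z : R) (y : Fpush chR e) : R^o :=
  contract_r lam (tswap (Psi (Fstar chT e (tens f f z y)))).

Fact slice_r_zmod z : zmod_morphism (slice_r z).
Proof.
move=> x y; apply: (addIr (slice_r z y)); rewrite subrK /slice_r.
apply: (etrans (esym (contract_rD lamD lamZ _ _))).
by rewrite -tswapD -raddfD /= -FstarD -tensDr subrK.
Qed.

Fact slice_r_scalable z : scalable (slice_r z).
Proof.
move=> r y; rewrite /slice_r.
have -> : tens f f z (r *: y) = tens f f 1 r ^+ (p ^ e) * tens f f z y.
  by rewrite tens_exp tensM expr1n mul1r.
by rewrite linear_Fstar_exp tswapM tswap_tens contract_r_mull.
Qed.

HB.instance Definition _ z :=
  GRing.isZmodMorphism.Build (Fpush chR e) R^o (slice_r z) (slice_r_zmod z).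
HB.instance Definition _ z :=
  GRing.isScalable.Build R (Fpush chR e) R^o *:%R (slice_r z) (slice_r_scalable z).

Definition slice_r_linear z : {linear Fpush chR e -> R^o} := slice_r z.

End DiagonalLift.

(** * Liftable splittings of large degree and the containment *)

(** Composing with the given splitting raises the degree by [e0 >= 1], and the composite of the
    lifts is a lift of the composite. *)
Lemma diag_F_split2_large (p : nat) (k R : comPzRingType) (f : {rmorphism k -> R})
    (chR : has_char p R) m : diag_F_split2 f chR ->
  exists e (psi : {linear Fpush chR e -> R^o}),
    [/\ diag_cartier2 f psi, is_F_splitting psi & (m < e)%N].
Proof.
move=> [e0 [psi0 [[Psi0 lift0] [e0_gt0 psi0_1]]]].
elim: m => [|m [e [psi [[Psi lift] [e_gt0 psi1] me]]]].
  by exists e0, psi0; split=> //; exists Psi0.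
exists (e0 + e)%N, (Fcomp_linear psi0 psi); split.
- exists (Fcomp_linear Psi0 Psi) => z.
  by rewrite !Fcomp_linearE lift0 lift.
- by split; [rewrite addn_gt0 e0_gt0 | rewrite Fcomp_linearE psi1].
by apply: leq_ltn_trans me _; rewrite -[X in (X < _)%N]add0n ltn_add2r.
Qed.

Theorem theorem4p2 (RR : realType) (p : nat) (k : fieldType)
    (chk : p \in [pchar k]) (R : comPzRingType) (f : {rmorphism k -> R})
    (a : set R) (s t : RR) (n : nat) :
  let chR : has_char p R := has_char_rmorph f (has_char_pchar chk) in
  F_finite (has_char_pchar chk) ->
  ess_finite_type f ->
  strongly_F_regular chR ->
  diag_F_split2 f chR ->
  is_ideal a ->
  (forall P : set R, is_minimal_prime P -> ~ (a `<=` P)) ->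
  0 < s -> 0 < t -> s + t = n%:R ->
  forall eps : RR, 0 < eps -> eps <= Num.min s t ->
    ideal_pow a n `<=`
      ideal_mul (test_ideal chR a (s - eps)) (test_ideal chR a (t - eps)).
Proof.
move=> chR _ _ regR splitR ida naP s0 t0 stn eps eps0.
rewrite le_min => /andP[eps_s eps_t].
set u := s - eps; set v := t - eps.
have u0 : 0 <= u by rewrite subr_ge0.
have v0 : 0 <= v by rewrite subr_ge0.
have [_ _ noethR _] := regR.
have [c ac cR] := minimal_prime_avoidance noethR ida naP.
have test (r : RR) : 0 <= r -> exists c', is_test_element chR a r c'.
  move=> r0; have rb := archi_boundP r0; exists (c ^+ Num.bound r).
  apply: Rcirc_test_element => //; exact: ltW.
have [cu testu] := test u u0; have [cv testv] := test v v0.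
have epsV0 : 0 <= eps^-1 by rewrite invr_ge0 ltW.
have [e [psi [[Psi lift] [_ psi1] large]]] :=
  diag_F_split2_large (Num.bound eps^-1) splitR.
set q : RR := p%:R ^+ e.
have p1 : (1 < p)%N by case/andP: (chR) => /prime_gt1.
have q0 : 0 <= q by rewrite exprn_ge0.
(* The degree exceeds [1 / eps] and [p ^ e > e], so [eps * q] is large enough to absorb one rounding
   error. *)
have epsq : 1 <= eps * q.
  rewrite -ler_pdivrMl // mulr1 (le_trans (ltW (archi_boundP epsV0))) //.
  by rewrite /q -natrX ler_nat (leq_trans (ltnW large)) // ltnW // ltn_expl.
have bound (r : RR) : 0 <= r -> exists2 N : nat, r * q <= N%:R & N%:R <= r * q + 1.
  move=> r0; have rq0 : 0 <= r * q by rewrite mulr_ge0.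
  (* This is one more than the ceiling when [r * q] is an integer; an error of at most 1 is all that
     is required. *)
  exists (Num.truncn (r * q)).+1; first by rewrite ltW // truncnS_gt.
  by rewrite -natr1 lerD2r truncn_le.
have [N uN Nu] := bound u u0; have [M vM Mv] := bound v v0.
have NMn : (N + M <= n * p ^ e)%N.
  rewrite -(ler_nat RR) natrD natrM natrX -/q -stn.
  apply: le_trans (lerD Nu Mv) _.
  (* Each of [s q] and [t q] exceeds [u q] and [v q] respectively by [eps q >= 1], which pays for
     rounding up to [N] and [M]. *)
  have -> : (s + t) * q = u * q + eps * q + (v * q + eps * q).
    by rewrite -!mulrDl !subrK.
  by apply: lerD; rewrite lerD2l.
move=> x ax.
have : ideal_mul (ideal_pow a N) (ideal_pow a M) (x ^+ (p ^ e)).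
  exact/(ideal_pow_split ida)/(ideal_pow_leq ida NMn)/ideal_pow_exp.
have : psi (Fstar chR e (x ^+ (p ^ e))) = x.
  by rewrite -[x ^+ _]mulr1 linear_Fstar_exp psi1 mulr1.
(* With [x] written as [psi] of its [p ^ e]-th power, additivity reduces the claim to a single
   product [y * z]. *)
move: (x ^+ _) => y <-; move: y; apply: add_span_ind => [|y z|_ [y [z [ay az ->]]]].
- by rewrite raddf0; apply: add_span0.
- by rewrite FstarD raddfD; apply: add_spanD.
(* The product is [mu (y ⊗ z)], so the lift turns its image under [psi] into [mu] of
   [Psi (y ⊗ z)]. *)
rewrite -(tensor_mu_tens f) -lift.
apply: tensor_mu_contract => lam lamD lamZ.
  pose phi := slice_l_linear chR Psi lamD lamZ z.
  exact: (test_ideal_linear ida u0 phi regR testu uN ay).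
pose phi := slice_r_linear chR Psi lamD lamZ y.
exact: (test_ideal_linear ida v0 phi regR testv vM az).
Qed.
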